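(* Let $R$ be a zero-sum-free commutative semiring. Sending a scenario $(\Sigma,O)$ to the bundle scenario $f_{(\Sigma,O)}:\mathcal{E}_O\Sigma\to\Sigma$, and a morphism $(\pi,\alpha)$ of scenarios to $(\pi,r(\alpha))$, specifies a fully faithful functor $\mathcal{E}:\mathbf{Scen}\to\mathbf{bScen}$. Moreover, the maps $\eta_{(\Sigma,O)}$ form a natural isomorphism $\eta:\mathrm{Emp}\to\mathrm{bEmp}\circ\mathcal{E}$ of functors $\mathbf{Scen}\to\mathbf{Set}$.
   Context: **Distributions.** $R$ is zero-sum-free if $a+b=0$ implies $a=b=0$. $D_R(U)$ is the set of finitely supported $p:U\to R$ with $\sum_u p(u)=1$; for $g:U\to V$, $D_R(g)(p)(v)=\sum_{u\in g^{-1}(v)}p(u)$. **Simplicial complexes.** A simplicial complex $\Sigma$ has a vertex set $\Sigma_0$ and a set of simplices (also written $\Sigma$): finite subsets of $\Sigma_0$, closed under taking subsets, containing all singletons; $\emptyset$ counts as a simplex. A map $f:\Gamma\to\Sigma$ is a function $\Gamma_0\to\Sigma_0$ with $f(\gamma)=\{f(x):x\in\gamma\}\in\Sigma$ for all $\gamma\in\Gamma$. The star of $\sigma$ is $\mathrm{St}(\sigma)=\{\sigma'\in\Sigma:\sigma\subset\sigma'\}$. **Category $\mathbf{Scen}$.** A scenario $(\Sigma,O)$ is a simplicial complex $\Sigma$ with a family $O=\{O_x\}_{x\in\Sigma_0}$ of nonempty sets. Put $\mathcal{E}_O(\sigma)=\prod_{x\in\sigma}O_x$, a contravariant functor (by restriction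 $s\mapsto s|_{\sigma'}$) on the poset $\mathcal C_\Sigma$ of simplices. A simplicial relation $\pi:\Sigma'\to\Sigma$ is a relation $\pi\subset\Sigma'_0\times\Sigma_0$ such that, with $\pi(x')=\{x:(x',x)\in\pi\}$, $\overline{\pi}(\sigma'):=\bigcup_{x'\in\sigma'}\pi(x')\in\Sigma$ for all $\sigma'\in\Sigma'$; it gives a functor $\overline\pi:\mathcal C_{\Sigma'}\to\mathcal C_\Sigma$. A morphism $(\Sigma,O)\to(\Sigma',O')$ is a pair $(\pi,\alpha)$ with $\pi:\Sigma'\to\Sigma$ a simplicial relation and $\alpha:\mathcal{E}_O\circ\overline\pi\to\mathcal{E}_{O'}$ a natural transformation. Composition: $(\pi',\alpha')\circ(\pi,\alpha)$ has relation with functor $\overline\pi\circ\overline{\pi'}$ and natural transformation with components $\alpha'_{\sigma''}\circ\alpha_{\overline{\pi'}(\sigma'')}$. **Functor $\mathrm{Emp}$.** $\mathrm{Emp}(\Sigma,O)$ is the set of families $e=\{e_\sigma\in D_R(\mathcal{E}_O(\sigma))\}_{\sigma\in\Sigma}$ such that for $\sigma'\subset\sigma$, $e_{\sigma'}$ is the push-forward of $e_\sigma$ under restriction. For a morphism, $((\pi,\alpha)_*e)_{\sigma'}=D_R(\alpha_{\sigma'})(e_{\overline\pi(\sigma')})$. **Category $\mathbf{bScen}$.** A bundle scenario is a map $f:\Gamma\to\Sigma$ of simplicial complexes that is surjective on simplices, locally surjective ($f:\mathrm{St}(\gamma)\to\mathrm{St}(f(\gamma))$ is surjective for every nonempty $\gamma\in\Gamma$),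 and discrete over vertices ($\{x,y\}\notin\Gamma$ for distinct $x,y\in\Gamma_0$ with $f(x)=f(y)$). The nerve complex $\hat N\Sigma$ has vertex set $\Sigma$ and simplices the finite sets $\{\sigma_1,\dots,\sigma_k\}$ with $\bigcup\sigma_i\in\Sigma$; $\hat N f$ is $\gamma\mapsto f(\gamma)$ on vertices. Simplicial relations $\Sigma'\to\Sigma$ are identified with simplicial complex maps $\pi:\Sigma'\to\hat N\Sigma$, $x'\mapsto\pi(x')$; Kleisli composition is $(\pi\diamond\pi')(x'')=\overline\pi(\pi'(x''))$. For $\pi:\Sigma'\to\hat N\Sigma$, $\pi^*(\hat N\Gamma)$ is the pull-back of $\hat Nf$ along $\pi$: vertices are pairs $(\gamma,x')\in\Gamma\times\Sigma'_0$ with $f(\gamma)=\pi(x')$, and a set $\{(\gamma_i,x'_i)\}_i$ is a simplex iff $\bigcup\gamma_i\in\Gamma$ and $\{x'_i\}_i\in\Sigma'$. Write $f^\pi:\pi^*(\hat N\Gamma)\to\Sigma'$ and $l:\pi^*(\hat N\Gamma)\to\hat N\Gamma$ for the projections. A morphism $(\pi,\alpha):f\to f'$, with $f':\Gamma'\to\Sigma'$, consists of simplicial complex maps $\pi:\Sigma'\to\hat N\Sigma$ and $\alpha:\pi^*(\hat N\Gamma)\to\Gamma'$ with $f'\circ\alpha=f^\pi$. Composition: $(\pi_2,\alpha_2)\circ(\pi_1,\alpha_1)=(\pi_1\diamond\pi_2,\ \alpha_2\circ\pi_2^*(\hat N\alpha_1))$, where $\pi_2^*(\hat N\alpha_1):\pi_2^*(\hat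 N\pi_1^*(\hat N\Gamma))\to\pi_2^*(\hat N\Gamma')$ is the pull-back of $\hat N\alpha_1$ and one identifies $\pi_2^*(\hat N\pi_1^*(\hat N\Gamma))\cong(\pi_1\diamond\pi_2)^*(\hat N\Gamma)$ via $(\{(\gamma_i,y_i)\}_i,x'')\mapsto(\bigcup_i\gamma_i,x'')$. The identity of $f$ is $(\delta_\Sigma,\mathrm{id}_\Gamma)$ with $\delta_\Sigma(x)=\{x\}$ (and $\delta_\Sigma^*(\hat N\Gamma)\cong\Gamma$). **Functor $\mathrm{bEmp}$.** Let $f:\Gamma\to\Sigma$ be a bundle scenario. For $\sigma'\subset\sigma$ in $\Sigma$ and $\gamma\in f^{-1}(\sigma)$ (i.e. $f(\gamma)=\sigma$) there is a unique $\gamma'\subset\gamma$ with $f(\gamma')=\sigma'$; let $r_{\sigma,\sigma'}(\gamma)=\gamma'$. $\mathrm{bEmp}(f)$ is the set of families $p=(p_\sigma\in D_R(f^{-1}(\sigma)))_{\sigma\in\Sigma}$ with $D_R(r_{\sigma,\sigma'})(p_\sigma)=p_{\sigma'}$ for $\sigma'\subset\sigma$. For $(\pi,\alpha):f\to f'$, $(\pi,\alpha)_*p=\alpha_*(\pi_*p)$, where $(\pi_*p)_{\sigma'}(\tau)=p_{\overline\pi(\sigma')}(\bigcup_{v\in\tau}l(v))$ for $\tau\in(f^\pi)^{-1}(\sigma')$, and $(\alpha_*q)_{\sigma'}=D_R(\alpha|_{(f^\pi)^{-1}(\sigma')})(q_{\sigma'})$. **The functor $\mathcal{E}$ and $\eta$.**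 $\mathcal{E}_O\Sigma$ has vertices $(x,o)$, $x\in\Sigma_0$, $o\in O_x$; its simplices are the pairs $(\sigma,s)$, $\sigma\in\Sigma$, $s\in\mathcal{E}_O(\sigma)$, viewed as the sets $\{(x,s(x)):x\in\sigma\}$; $f_{(\Sigma,O)}(\sigma,s)=\sigma$. For a simplicial relation $\pi:\Sigma'\to\Sigma$, the pull-back $\pi^*(\hat N(\mathcal{E}_O\Sigma))$ is identified with the simplicial complex having vertices $(x',s)$, $x'\in\Sigma'_0$, $s\in\mathcal{E}_O(\pi(x'))$, and simplices $(\sigma',s)$, $\sigma'\in\Sigma'$, $s\in\mathcal{E}_O(\overline\pi(\sigma'))$, the latter viewed as $\{(x',s|_{\pi(x')}):x'\in\sigma'\}$, with $l(x',s)=(\pi(x'),s)$. Then $r(\alpha)(\sigma',s)=(\sigma',\alpha_{\sigma'}(s))$. Finally $\eta_{(\Sigma,O)}:\mathrm{Emp}(\Sigma,O)\to\mathrm{bEmp}(f_{(\Sigma,O)})$ is defined by $\eta_{(\Sigma,O)}(e)_\sigma(\sigma,s)=e_\sigma(s)$. *)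

(* Defs.v *)
From HB Require Import structures.
From mathcomp Require Import all_boot ssralg finmap boolp.

Set Implicit Arguments.
Unset Strict Implicit.
Unset Printing Implicit Defensive.

Import GRing.Theory.
Local Open Scope fset_scope.

Record category := Category {
  obj :> Type;
  hom : obj -> obj -> Type;
  idm : forall X, hom X X;
  compm : forall X Y Z, hom Y Z -> hom X Y -> hom X Z;
  comp1m : forall X Y (m : hom X Y), compm (idm Y) m = m;
  compm1 : forall X Y (m : hom X Y), compm m (idm X) = m;
  compmA : forall W X Y Z (m : hom Y Z) (n : hom X Y) (q : hom W X),
    compm m (compm n q) = compm (compm m n) q }.
Arguments idm {c} X.
Arguments compm {c X Y Z}.

Record functor_data (C D : category) := FunctorData {
  fob :> C -> D;
  fmor : forall X Y, hom X Y -> hom (fob X) (fob Y) }.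
Arguments fmor {C D} f {X Y}.

Definition is_functor (C D : category) (F : functor_data C D) : Prop :=
  (forall X, fmor F (idm X) = idm (F X)) /\
  (forall X Y Z (m : hom Y Z) (n : hom X Y),
     fmor F (compm m n) = compm (fmor F m) (fmor F n)).

Record functor (C D : category) := Functor {
  fdata :> functor_data C D;
  functorP : is_functor fdata }.

Lemma comp_functorP (C D E : category) (G : functor D E) (F : functor C D) :
  is_functor (FunctorData (fun X Y (m : hom X Y) => fmor G (fmor F m))).
Proof.
split=> [X|X Y Z m n] /=; first by rewrite (functorP F).1 (functorP G).1.
by rewrite (functorP F).2 (functorP G).2.
Qed.

Definition comp_functor (C D E : category) (G : functor D E) (F : functor C D) :
  functor C E := Functor (comp_functorP G F).

Definition fully_faithful (C D : category) (F : functor C D) : Prop :=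
  forall X Y, bijective (@fmor C D F X Y).

Record nat_trans (C D : category) (F G : functor C D) := NatTrans {
  ncomp :> forall X, hom (F X) (G X);
  ncompP : forall X Y (m : hom X Y),
    compm (fmor G m) (ncomp X) = compm (ncomp Y) (fmor F m) }.

Definition is_iso (C : category) (X Y : C) (m : hom X Y) : Prop :=
  exists n : hom Y X, compm n m = idm X /\ compm m n = idm Y.

Definition is_nat_iso (C D : category) (F G : functor C D)
  (eta : nat_trans F G) : Prop := forall X, is_iso (eta X).

Definition SetCat : category :=
  @Category Type (fun A B => A -> B) (fun A x => x)
    (fun A B C m n x => m (n x)) (fun _ _ _ => erefl) (fun _ _ _ => erefl)
    (fun _ _ _ _ _ _ _ => erefl).

Definition zero_sum_free (R : comPzSemiRingType) : Prop :=
  forall a b : R, (a + b = 0 -> a = 0 /\ b = 0)%R.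

Record dist (R : comPzSemiRingType) (U : choiceType) := Dist {
  dval :> {fsfun U -> R with 0%R};
  distP : (\sum_(u <- finsupp dval) dval u == 1)%R }.

Lemma dist_eq (R : comPzSemiRingType) (U : choiceType) (p q : dist R U) :
  (forall u, p u = q u) -> p = q.
Proof.
case: p q => [p hp] [q hq] /= /fsfunP E; rewrite {}E in hp *.
by rewrite (bool_irrelevance hp hq).
Qed.

Section Push.
Variables (R : comPzSemiRingType) (U V : choiceType) (g : U -> V) (p : dist R U).

Definition push_fsfun : {fsfun V -> R with 0%R} :=
  [fsfun v in g @` finsupp p => (\sum_(u <- finsupp p | g u == v) p u)%R].

Lemma push_fsfunE v :
  push_fsfun v = (\sum_(u <- finsupp p | g u == v) p u)%R.
Proof.
rewrite fsfunE; case: ifPn => // vN; rewrite big_seq_cond big1 // => u.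
by case/andP => uP /eqP guv; case/negP: vN; rewrite -guv in_imfset.
Qed.

Lemma big_finsupp (W : choiceType) (q : {fsfun W -> R with 0%R}) (A : {fset W}) :
  finsupp q `<=` A -> (\sum_(w <- finsupp q) q w = \sum_(w <- A) q w)%R.
Proof.
move=> sub; apply: big_fset_incl => // w _; exact: fsfun_dflt.
Qed.

Lemma push_subproof : (\sum_(v <- finsupp push_fsfun) push_fsfun v == 1)%R.
Proof.
rewrite (@big_finsupp _ _ (g @` finsupp p)); last exact: finsupp_sub.
under eq_bigr do rewrite push_fsfunE.
by rewrite -(partition_big_imfset _ g (finsupp p) (fun u => p u)) (eqP (distP p)).
Qed.

Definition push : dist R V := Dist push_subproof.
End Push.

Lemma pushE (R : comPzSemiRingType) (U V : choiceType) (g : U -> V)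
    (p : dist R U) v :
  push g p v = (\sum_(u <- finsupp p | g u == v) p u)%R.
Proof. exact: push_fsfunE. Qed.

Lemma pushE_sub (R : comPzSemiRingType) (U V : choiceType) (g : U -> V)
    (p : dist R U) (A : {fset U}) v :
  finsupp p `<=` A -> push g p v = (\sum_(u <- A | g u == v) p u)%R.
Proof.
move=> sub; rewrite pushE big_mkcond [RHS]big_mkcond /=.
apply: big_fset_incl => // u _ uN; case: ifP => // _; exact: fsfun_dflt.
Qed.

Lemma eq_push (R : comPzSemiRingType) (U V : choiceType) (g h : U -> V)
  (p : dist R U) : g =1 h -> push g p = push h p.
Proof.
move=> E; apply: dist_eq => v; rewrite !pushE.
by apply: eq_bigl => u; rewrite E.
Qed.

Lemma push_id (R : comPzSemiRingType) (U : choiceType) (g : U -> U)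
  (p : dist R U) : g =1 id -> push g p = p.
Proof.
move=> E; apply: dist_eq => v; rewrite pushE.
under eq_bigl do rewrite E.
case: (finsuppP p v) => [vN|vP].
  rewrite big_seq_cond big1 // => u /andP[uP /eqP uv].
  by rewrite uv (negPf vN) in uP.
rewrite -big_filter (perm_big [:: v]) ?big_seq1 //.
by apply: uniq_perm; rewrite ?filter_uniq ?fset_uniq // => u;
   rewrite mem_filter inE; case: eqP => // ->; rewrite vP.
Qed.

Lemma push_comp (R : comPzSemiRingType) (U V W : choiceType) (g : U -> V)
    (h : V -> W) (p : dist R U) :
  push h (push g p) = push (h \o g) p.
Proof.
apply: dist_eq => w.
rewrite (@pushE_sub _ _ _ _ (push g p) (g @` finsupp p)); last exact: finsupp_sub.
under eq_bigr do rewrite pushE.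
rewrite pushE [RHS]big_mkcond /= (partition_big_imfset _ g) /= big_mkcond /=.
apply: eq_bigr => v _; case: ifP => [/eqP <-|hv].
  by rewrite -big_mkcondr; apply: eq_bigl => u; case: eqP => [->|//]; rewrite eqxx.
by rewrite big1 // => u /eqP ->; rewrite hv.
Qed.

Lemma push_inj (R : comPzSemiRingType) (U V : choiceType) (g : U -> V)
    (p : dist R U) u : injective g -> push g p (g u) = p u.
Proof.
move=> gI; rewrite pushE -[RHS](congr1 (fun q : dist R U => q u) (@push_id _ _ id p (frefl _))) pushE.
by apply: eq_bigl => x; rewrite inj_eq.
Qed.

(* Simplices form a boolean predicate; a propositional one P is turned into
   fun K => `[< P K >], so that this is no restriction. *)
Record complex := Complex {
  vert :> choiceType;
  simp : pred {fset vert};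
  simp0 : simp fset0;
  simp1 : forall x, simp [fset x];
  simpS : forall s t : {fset vert}, t `<=` s -> simp s -> simp t }.
Arguments simp : clear implicits.

Notation simplex S := {s : {fset vert S} | simp S s}.

Record smap (G S : complex) := SMap {
  sfun :> vert G -> vert S;
  smapP : forall g, simp G g -> simp S (sfun @` g) }.

Lemma smap_eq (G S : complex) (f g : smap G S) : f =1 g -> f = g.
Proof.
case: f g => [f hf] [g hg] /= /funext E; rewrite {}E in hf *.
by rewrite (Prop_irrelevance hf hg).
Qed.

Lemma smap_compP (A B C : complex) (g : smap B C) (f : smap A B) s :
  simp A s -> simp C ((g \o f) @` s).
Proof. by move=> /(smapP f) /(smapP g); rewrite -imfset_comp. Qed.
Definition smap_comp (A B C : complex) (g : smap B C) (f : smap A B) :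
  smap A C := SMap (smap_compP g f).

Definition sections (V : choiceType) (O : V -> choiceType) (s : {fset V}) :
  choiceType := {dffun forall x : s, O (val x)}.

Definition restr (V : choiceType) (O : V -> choiceType) (s t : {fset V})
    (h : t `<=` s) (f : sections O s) : sections O t :=
  [ffun x : t => f (fincl h x)].

Lemma sections_irr (V : choiceType) (O : V -> choiceType) (s : {fset V})
    (f : sections O s) x (p q : x \in s) : f [` p] = f [` q].
Proof. by rewrite (bool_irrelevance p q). Qed.

Lemma restr_comp (V : choiceType) (O : V -> choiceType) (r s t : {fset V})
   (h : t `<=` s) (k : s `<=` r) (l : t `<=` r) (f : sections O r) :
  restr h (restr k f) = restr l f.
Proof. by apply/ffunP => -[x xt]; rewrite !ffunE; apply: sections_irr. Qed.

Lemma restr_comp3 (V : choiceType) (O : V -> choiceType)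
    (q r s t u : {fset V}) (a : t `<=` s) (b : s `<=` r) (c : r `<=` q)
    (d : t `<=` u) (e : u `<=` q) (f : sections O q) :
  restr d (restr e f) = restr a (restr b (restr c f)).
Proof.
by rewrite (restr_comp b c (fsubset_trans b c)) !(restr_comp _ _ (fsubset_trans d e)).
Qed.

Lemma restr_id (V : choiceType) (O : V -> choiceType) (s : {fset V})
   (h : s `<=` s) (f : sections O s) : restr h f = f.
Proof. by apply/ffunP => -[x xt]; rewrite !ffunE; apply: sections_irr. Qed.

Definition ubar (V W : choiceType) (p : V -> {fset W}) (s : {fset V}) :
  {fset W} := \bigcup_(x <- s) p x.

Lemma ubarP (V W : choiceType) (p : V -> {fset W}) (s : {fset V}) w :
  reflect (exists2 x, x \in s & w \in p x) (w \in ubar p s).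
Proof.
apply: (iffP (bigfcupP _ _ _ _)) => [[x /andP[xs _] wx]|[x xs wx]].
  by exists x.
by exists x; rewrite ?xs.
Qed.

Lemma ubarS (V W : choiceType) (p : V -> {fset W}) (s t : {fset V}) :
  t `<=` s -> ubar p t `<=` ubar p s.
Proof.
move=> /fsubsetP ts; apply/fsubsetP => w /ubarP[x xt wx].
by apply/ubarP; exists x; rewrite ?ts.
Qed.

Lemma ubar1 (V W : choiceType) (p : V -> {fset W}) x : ubar p [fset x] = p x.
Proof.
apply/fsetP => w; apply/ubarP/idP => [[y /fset1P ->] //|wx].
by exists x; rewrite ?fset11.
Qed.

Record scenario := Scenario {
  sbase : complex;
  sout : vert sbase -> choiceType;
  soutP : forall x, inhabited (sout x) }.

(* A simplicial relation is given by its fibers rfun x' = pi(x'). They are finite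
   in any case, since {x'} is a simplex and hence so is pi(x'). *)
Record srel (S' S : complex) := SRel {
  rfun :> vert S' -> {fset vert S};
  srelP : forall s, simp S' s -> simp S (ubar rfun s) }.

Definition rbar (S' S : complex) (p : srel S' S) (s : simplex S') : simplex S :=
  exist _ (ubar p (val s)) (srelP p (valP s)).

Lemma srel_eq (S' S : complex) (p q : srel S' S) : p =1 q -> p = q.
Proof.
case: p q => [f hf] [g hg] /= /funext E; rewrite {}E in hf *.
by rewrite (Prop_irrelevance hf hg).
Qed.

Lemma srel_idP (S : complex) s : simp S s -> simp S (ubar (fun x => [fset x]) s).
Proof. by rewrite /ubar bigfcup_imfset1 imfset_id. Qed.
Definition srel_id (S : complex) : srel S S := SRel (@srel_idP S).

Lemma ubar_comp (V W X : choiceType) (p : W -> {fset X}) (q : V -> {fset W}) s :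
  ubar (fun x => ubar p (q x)) s = ubar p (ubar q s).
Proof.
apply/fsetP => x; apply/ubarP/ubarP => [[v vs /ubarP[w wv xw]]|[w /ubarP[v vs wv] xw]].
  by exists w => //; apply/ubarP; exists v.
by exists v => //; apply/ubarP; exists w.
Qed.

Lemma srel_compP (A B C : complex) (p : srel B C) (q : srel A B) s :
  simp A s -> simp C (ubar (fun x => ubar p (q x)) s).
Proof. by rewrite ubar_comp => /(srelP q) /(srelP p). Qed.
Definition srel_comp (A B C : complex) (p : srel B C) (q : srel A B) :
  srel A C := SRel (srel_compP p q).

Record scen_mor (S T : scenario) := ScenMor {
  sm_rel : srel (sbase T) (sbase S);
  sm_nat : forall s : simplex (sbase T),
    sections (@sout S) (val (rbar sm_rel s)) -> sections (@sout T) (val s);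
  sm_natP : forall (s t : simplex (sbase T)) (h : val t `<=` val s) f,
    restr h (sm_nat f) = sm_nat (s := t) (restr (ubarS sm_rel h) f) }.
Arguments sm_nat {S T} m s _ : rename.
Arguments sm_natP {S T} m {s t} h f : rename.

Lemma scen_mor_eq (S T : scenario) (m n : scen_mor S T) :
  sm_rel m =1 sm_rel n ->
  (forall s (h : ubar (sm_rel n) (val s) `<=` ubar (sm_rel m) (val s)) f,
     sm_nat m s f = sm_nat n s (restr h f)) -> m = n.
Proof.
case: m n => [p a ha] [q b hb] /= /srel_eq E; move: a ha; rewrite {}E => a ha ab.
have {}ab : a = b.
  apply: functional_extensionality_dep => s; apply: funext => f.
  rewrite (ab s (fsubset_refl _)); congr (b s _); exact: restr_id.
by rewrite {}ab in ha *; rewrite (Prop_irrelevance ha hb).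
Qed.

Lemma scen_id_sub (S : complex) (s : {fset S}) : s `<=` ubar (srel_id S) s.
Proof. by rewrite /ubar bigfcup_imfset1 imfset_id. Qed.

Lemma scen_idP (S : scenario) (s t : simplex (sbase S)) (h : val t `<=` val s)
    (f : sections (@sout S) (val (rbar (srel_id (sbase S)) s))) :
  restr h (restr (scen_id_sub (val s)) f) =
  restr (scen_id_sub (val t)) (restr (ubarS (srel_id (sbase S)) h) f).
Proof.
rewrite (restr_comp _ _ (fsubset_trans h (scen_id_sub (val s)))).
by rewrite (restr_comp _ _ (fsubset_trans h (scen_id_sub (val s)))).
Qed.

(* ubar (srel_id _) s and s are equal but not convertible, so that the identity
   transformation is the restriction along this equality; likewise in
   scen_comp_nat for ubar (srel_comp p q) s and ubar p (ubar q s). *)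
Definition scen_id (S : scenario) : scen_mor S S :=
  @ScenMor S S (srel_id (sbase S)) (fun s f => restr (scen_id_sub (val s)) f)
    (@scen_idP S).

Lemma scen_comp_sub (A B C : complex) (p : srel B C) (q : srel A B)
  (s : {fset A}) : ubar p (ubar q s) `<=` ubar (srel_comp p q) s.
Proof. by rewrite [X in _ `<=` X]ubar_comp. Qed.

Definition scen_comp_nat (S T U : scenario) (n : scen_mor T U)
    (m : scen_mor S T) (s : simplex (sbase U))
    (f : sections (@sout S) (val (rbar (srel_comp (sm_rel m) (sm_rel n)) s))) :
  sections (@sout U) (val s) :=
  sm_nat n s (sm_nat m (rbar (sm_rel n) s) (restr (scen_comp_sub _ _ (val s)) f)).
Arguments scen_comp_nat {S T U} n m s f.

Lemma scen_comp_natP (S T U : scenario) (n : scen_mor T U)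
    (m : scen_mor S T) (s t : simplex (sbase U)) (h : val t `<=` val s) f :
  restr h (scen_comp_nat n m s f) =
  scen_comp_nat n m t (restr (ubarS (srel_comp (sm_rel m) (sm_rel n)) h) f).
Proof.
rewrite /scen_comp_nat sm_natP; congr (sm_nat n t _).
rewrite (sm_natP m (s := rbar (sm_rel n) s) (t := rbar (sm_rel n) t)).
congr (sm_nat m _ _).
have l : ubar (sm_rel m) (ubar (sm_rel n) (val t)) `<=`
  ubar (srel_comp (sm_rel m) (sm_rel n)) (val s).
  apply: fsubset_trans (scen_comp_sub _ _ _); do 2 apply: ubarS; exact: h.
by rewrite (restr_comp _ _ l) (restr_comp _ _ l).
Qed.

Definition scen_comp (S T U : scenario) (n : scen_mor T U) (m : scen_mor S T) :
  scen_mor S U := ScenMor (@scen_comp_natP S T U n m).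

Lemma scen_comp1m (S T : scenario) (m : scen_mor S T) :
  scen_comp (scen_id T) m = m.
Proof.
apply: scen_mor_eq => [x|s h f]; first by rewrite /= ubar1.
rewrite /= /scen_comp_nat /=.
have N := @sm_natP _ _ m (rbar (srel_id (sbase T)) s) s (scen_id_sub (val s)).
apply: etrans (N _) _; congr (sm_nat m s _); exact: restr_comp.
Qed.

Lemma scen_compm1 (S T : scenario) (m : scen_mor S T) :
  scen_comp m (scen_id S) = m.
Proof.
apply: scen_mor_eq => [x|s h f].
  by rewrite /= /ubar bigfcup_imfset1 imfset_id.
rewrite /= /scen_comp_nat /=; congr (sm_nat m s _); exact: restr_comp.
Qed.

Lemma scen_compA (S T U V : scenario) (m : scen_mor U V) (n : scen_mor T U)
    (q : scen_mor S T) :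
  scen_comp m (scen_comp n q) = scen_comp (scen_comp m n) q.
Proof.
apply: scen_mor_eq => [x|s h f]; first by rewrite /= ubar_comp.
rewrite /= /scen_comp_nat /=; congr (sm_nat m s _); congr (sm_nat n _ _).
have N := @sm_natP _ _ q (rbar (srel_comp (sm_rel n) (sm_rel m)) s)
  (rbar (sm_rel n) (rbar (sm_rel m) s)) (scen_comp_sub _ _ _).
apply: etrans _ (esym (N _)); congr (sm_nat q _ _).
by apply: restr_comp3.
Qed.

Definition Scen : category :=
  Category scen_comp1m scen_compm1 scen_compA.

Section Emp.
Variable R : comPzSemiRingType.

Definition emp (S : scenario) : Type :=
  {e : forall s : simplex (sbase S), dist R (sections (@sout S) (val s)) |
     forall (s t : simplex (sbase S)) (h : val t `<=` val s),
       push (restr h) (e s) = e t}.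

Lemma emp_eq (S : scenario) (e e' : emp S) :
  (forall s, sval e s = sval e' s) -> e = e'.
Proof.
case: e e' => [e he] [e' he'] /= E0.
have E : e = e' by exact: functional_extensionality_dep.
by rewrite {}E in he *; rewrite (Prop_irrelevance he he').
Qed.

Lemma emp_morP (S T : scenario) (m : scen_mor S T) (e : emp S)
    (s t : simplex (sbase T)) (h : val t `<=` val s) :
  push (restr h) (push (sm_nat m s) (sval e (rbar (sm_rel m) s))) =
  push (sm_nat m t) (sval e (rbar (sm_rel m) t)).
Proof.
rewrite push_comp -(svalP e (rbar _ s) (rbar _ t) (ubarS _ h)) push_comp.
by apply: eq_push => f /=; rewrite sm_natP.
Qed.

Definition emp_mor (S T : scenario) (m : scen_mor S T) (e : emp S) : emp T :=
  exist _ (fun s => push (sm_nat m s) (sval e (rbar (sm_rel m) s)))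
    (@emp_morP S T m e).

Lemma emp_functorP : @is_functor Scen SetCat (@FunctorData Scen SetCat emp emp_mor).
Proof.
split=> [S|S T U n m]; apply: funext => e; apply: emp_eq => s /=.
  by rewrite (svalP e (rbar (srel_id _) s) s).
rewrite push_comp -(svalP e (rbar (srel_comp (sm_rel m) (sm_rel n)) s)
  (rbar (sm_rel m) (rbar (sm_rel n) s)) (scen_comp_sub _ _ _)) push_comp.
exact: eq_push.
Qed.

Definition Emp : functor Scen SetCat := Functor emp_functorP.
End Emp.

Section Nerve.
Variable S : complex.

Definition nsimp : pred {fset simplex S} :=
  fun K => simp S (\bigcup_(s <- K) val s).

Lemma nsimp0 : nsimp fset0.
Proof. by rewrite /nsimp big_seq_fset0 simp0. Qed.

Lemma nsimp1 s : nsimp [fset s].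
Proof. by rewrite /nsimp big_seq_fset1 (valP s). Qed.

Lemma nsimpS (K L : {fset simplex S}) : L `<=` K -> nsimp K -> nsimp L.
Proof. move=> LK; apply: simpS; exact: (@ubarS _ _ (fun s => val s)). Qed.

Definition nerve : complex := Complex nsimp0 nsimp1 nsimpS.
End Nerve.

Definition image_simplex (G S : complex) (f : smap G S) (g : simplex G) :
  simplex S := exist _ (f @` val g) (smapP f (valP g)).

Lemma imfset_bigcup (V W X : choiceType) (f : W -> X) (p : V -> {fset W})
    (s : {fset V}) : f @` ubar p s = ubar (fun x => f @` p x) s.
Proof.
apply/fsetP => x; apply/imfsetP/ubarP => /=.
  by case=> w /ubarP[v vs wv] ->; exists v => //; rewrite in_imfset.
by case=> v vs /imfsetP[w /= wv ->]; exists w => //; apply/ubarP; exists v.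
Qed.

Lemma ubar_imfset (V W X : choiceType) (f : V -> W) (p : W -> {fset X})
    (s : {fset V}) : ubar p (f @` s) = ubar (fun x => p (f x)) s.
Proof.
apply/fsetP => x; apply/ubarP/ubarP => [[w /imfsetP[v /= vs ->] xv]|[v vs xv]].
  by exists v.
by exists (f v); rewrite ?in_imfset.
Qed.

Lemma nerve_simpE (S : complex) (K : {fset nerve S}) :
  simp (nerve S) K = simp S (ubar (fun s : simplex S => val s) K).
Proof. by []. Qed.

Lemma nerve_simp_image (V : choiceType) (S : complex) (F : V -> simplex S)
    (K : {fset V}) :
  simp (nerve S) (F @` K) = simp S (ubar (fun x => val (F x)) K).
Proof. by rewrite nerve_simpE ubar_imfset. Qed.

Lemma nerve_mapP (G S : complex) (f : smap G S) (K : {fset nerve G}) :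
  simp (nerve G) K -> simp (nerve S) (image_simplex f @` K).
Proof.
rewrite nerve_simpE nerve_simp_image /= => /(smapP f).
by rewrite imfset_bigcup.
Qed.

Definition nerve_map (G S : complex) (f : smap G S) :
  smap (nerve G) (nerve S) := SMap (@nerve_mapP G S f).

Section Pullback.
Variables (A B C : complex) (g : smap A C) (h : smap B C).

Definition pbvert : choiceType := {p : vert A * vert B | g p.1 == h p.2}.

Definition pbsimp : pred {fset pbvert} := fun K =>
  simp A [fset (val w).1 | w in K] && simp B [fset (val w).2 | w in K].

Lemma pbsimp0 : pbsimp fset0.
Proof. by rewrite /pbsimp !imfset0 !simp0. Qed.

Lemma pbsimp1 w : pbsimp [fset w].
Proof. by rewrite /pbsimp !imfset_fset1 !simp1. Qed.

Lemma pbsimpS (K L : {fset pbvert}) : L `<=` K -> pbsimp K -> pbsimp L.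
Proof.
move=> /fsubsetP LK /andP[KA KB]; apply/andP; split.
  by apply: simpS KA; apply: subset_imfset.
by apply: simpS KB; apply: subset_imfset.
Qed.

Definition pullback : complex := Complex pbsimp0 pbsimp1 pbsimpS.

Lemma pb_simpE K : simp pullback K =
  simp A [fset (val w).1 | w in K] && simp B [fset (val w).2 | w in K].
Proof. by []. Qed.

Lemma pb_fstP (K : {fset pullback}) :
  simp pullback K -> simp A [fset (val w).1 | w in K].
Proof. by case/andP. Qed.
Lemma pb_sndP (K : {fset pullback}) :
  simp pullback K -> simp B [fset (val w).2 | w in K].
Proof. by case/andP. Qed.
Definition pb_fst : smap pullback A := SMap pb_fstP.
Definition pb_snd : smap pullback B := SMap pb_sndP.
End Pullback.

Lemma pb_mapP (A A' B C : complex) (g : smap A C) (g' : smap A' C)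
    (h : smap B C) (a : smap A A') (ag : forall x, g' (a x) = g x)
    (w : pullback g h) : g' (a (val w).1) == h (val w).2.
Proof. by rewrite ag (valP w). Qed.

Lemma pb_map_simpP (A A' B C : complex) (g : smap A C) (g' : smap A' C)
    (h : smap B C) (a : smap A A') (ag : forall x, g' (a x) = g x) K :
  simp (pullback g h) K ->
  simp (pullback g' h)
    [fset (exist _ (a (val w).1, (val w).2) (pb_mapP ag w) : pullback g' h)
      | w in K].
Proof.
case/andP => KA KB; apply/andP; rewrite -!imfset_comp /=; split=> //.
by move: (smapP a KA); rewrite -imfset_comp.
Qed.

Definition pb_map (A A' B C : complex) (g : smap A C) (g' : smap A' C)
    (h : smap B C) (a : smap A A') (ag : forall x, g' (a x) = g x) :
  smap (pullback g h) (pullback g' h) := SMap (pb_map_simpP ag).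

Record is_bundle (G S : complex) (f : smap G S) : Prop := IsBundle {
  bundle_surj : forall s, simp S s -> exists2 g, simp G g & f @` g = s;
  bundle_lsurj : forall g, simp G g -> g != fset0 ->
    forall s, simp S s -> f @` g `<=` s ->
    exists g', [/\ simp G g', g `<=` g' & f @` g' = s];
  bundle_disc : forall x y, x != y -> f x = f y -> ~~ simp G [fset x; y] }.

Record bscenario := BScenario {
  btot : complex;
  bbase : complex;
  bmap :> smap btot bbase;
  bmapP : is_bundle bmap }.

(* The restriction map r of a bundle scenario: if s is contained in f(g), then
   face f g s is the unique subset of g with image s (image_face, face_uniq). *)
Definition face (G S : complex) (f : smap G S) (g : {fset G}) (s : {fset S}) :
  {fset G} := [fset v in g | f v \in s].

Lemma in_face (G S : complex) (f : smap G S) (g : {fset G}) (s : {fset S}) v :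
  (v \in face f g s) = (v \in g) && (f v \in s).
Proof. by rewrite !inE. Qed.

Lemma face_sub (G S : complex) (f : smap G S) g s : face f g s `<=` g.
Proof. by apply/fsubsetP => v; rewrite in_face => /andP[]. Qed.

Lemma face_simp (G S : complex) (f : smap G S) g s :
  simp G g -> simp G (face f g s).
Proof. apply: simpS; exact: face_sub. Qed.

Lemma image_face (G S : complex) (f : smap G S) (g : {fset G}) (s : {fset S}) :
  s `<=` f @` g -> f @` face f g s = s.
Proof.
move=> /fsubsetP sg; apply/fsetP => x; apply/imfsetP/idP => /=.
  by case=> v; rewrite in_face => /andP[_ fv] ->.
move=> xs; have /imfsetP[v /= vg xv] := sg _ xs.
by exists v; rewrite // in_face vg -xv.
Qed.

Lemma bundle_inj (f : bscenario) g : simp (btot f) g ->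
  {in g &, injective f}.
Proof.
move=> gP x y xg yg fxy; apply/eqP/negP => /negP xy.
case/negP: (bundle_disc (bmapP f) xy fxy); apply: simpS gP.
by apply/fsubsetP => z /fset2P[] ->.
Qed.

Lemma face_uniq (f : bscenario) g g' s : simp (btot f) g -> g' `<=` g ->
  f @` g' = s -> g' = face f g s.
Proof.
move=> gP /fsubsetP g'g <-; apply/fsetP => v; rewrite in_face.
apply/idP/andP => [vg'|[vg /imfsetP[u /= ug' fvu]]].
  by split; [exact: g'g|rewrite in_imfset].
by rewrite (bundle_inj gP vg (g'g _ ug') fvu).
Qed.

Definition fiber (G S : complex) (f : smap G S) (s : {fset S}) : choiceType :=
  {g : {fset G} | simp G g && (f @` g == s)}.

Lemma fiberP1 (G S : complex) (f : smap G S) s (g : fiber f s) : simp G (val g).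
Proof. by case/andP: (valP g). Qed.

Lemma fiberP2 (G S : complex) (f : smap G S) s (g : fiber f s) : f @` val g = s.
Proof. by case/andP: (valP g) => _ /eqP. Qed.

Lemma res_fiberP (G S : complex) (f : smap G S) (s t : {fset S}) (h : t `<=` s)
    (g : fiber f s) :
  simp G (face f (val g) t) && (f @` face f (val g) t == t).
Proof.
by rewrite face_simp ?fiberP1 //= image_face ?fiberP2.
Qed.

Definition res_fiber (G S : complex) (f : smap G S) (s t : {fset S})
  (h : t `<=` s) (g : fiber f s) : fiber f t :=
  exist _ (face f (val g) t) (res_fiberP h g).

Definition nbar (S' S : complex) (p : smap S' (nerve S)) : {fset S'} -> {fset S} :=
  ubar (fun x => val (p x)).

Lemma nbarP (S' S : complex) (p : smap S' (nerve S)) s :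
  simp S' s -> simp S (nbar p s).
Proof.
by move=> /(smapP p); rewrite nerve_simp_image.
Qed.

Definition nbar_simplex (S' S : complex) (p : smap S' (nerve S))
  (s : simplex S') : simplex S := exist _ (nbar p (val s)) (nbarP p (valP s)).

Lemma kleisliP (S'' S' S : complex) (p : smap S' (nerve S))
    (q : smap S'' (nerve S')) s :
  simp S'' s -> simp (nerve S) ((fun x => nbar_simplex p (q x)) @` s).
Proof.
move=> sP; rewrite nerve_simp_image /= /nbar.
by rewrite ubar_comp; apply: (nbarP p (nbarP q sP)).
Qed.

Definition kleisli (S'' S' S : complex) (p : smap S' (nerve S))
  (q : smap S'' (nerve S')) : smap S'' (nerve S) := SMap (kleisliP p q).

Lemma nbar_kleisli (S'' S' S : complex) (p : smap S' (nerve S))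
    (q : smap S'' (nerve S')) s : nbar (kleisli p q) s = nbar p (nbar q s).
Proof. by rewrite /nbar /= ubar_comp. Qed.

Section Glue.
Variables (G S S' : complex) (f : smap G S) (p : smap S' (nerve S)).

Notation P := (pullback (nerve_map f) p).

Definition glue (K : {fset P}) : {fset G} := \bigcup_(w <- K) val (val w).1.

Lemma in_glue (K : {fset P}) v :
  reflect (exists2 w, w \in K & v \in val (val w).1) (v \in glue K).
Proof. exact: ubarP. Qed.

Lemma pb_val (w : P) : f @` val (val w).1 = val (p (val w).2).
Proof. by have /eqP/(congr1 val) := valP w. Qed.

Lemma pb_eq (w w' : P) : val (val w).1 = val (val w').1 ->
  (val w).2 = (val w').2 -> w = w'.
Proof.
case: w w' => [[g x] h] [[g' x'] h'] /= E1 E2; apply: val_inj => /=.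
by rewrite E2; congr pair; apply: val_inj.
Qed.

Lemma glue_simp (K : {fset P}) : simp P K -> simp G (glue K).
Proof.
by rewrite pb_simpE nerve_simp_image => /andP[].
Qed.

Lemma image_glue (K : {fset P}) :
  f @` glue K = nbar p [fset (val w).2 | w in K].
Proof.
rewrite imfset_bigcup /nbar ubar_imfset.
by apply/fsetP => x; apply/ubarP/ubarP => -[w wK wx]; exists w => //;
  move: wx; rewrite pb_val.
Qed.

Lemma glue_fiberP (s : {fset S'}) (K : fiber (pb_snd (nerve_map f) p) s) :
  simp G (glue (val K)) && (f @` glue (val K) == nbar p s).
Proof.
rewrite glue_simp ?(fiberP1 K) //= image_glue; apply/eqP; congr (nbar p _).
exact: (fiberP2 K).
Qed.

Definition glue_fiber (s : {fset S'}) (K : fiber (pb_snd (nerve_map f) p) s) :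
  fiber f (nbar p s) := exist _ (glue (val K)) (glue_fiberP K).

Lemma nbar_sub (s : {fset S'}) x : x \in s -> val (p x) `<=` nbar p s.
Proof. by move=> xs; apply/fsubsetP => v vx; apply/ubarP; exists x. Qed.

Definition piece_simplex (s : {fset S'}) (g : fiber f (nbar p s)) (x : S') :
  simplex G := exist _ (face f (val g) (val (p x))) (face_simp f _ (fiberP1 g)).

Lemma pieceP (s : {fset S'}) (g : fiber f (nbar p s)) (x : s) :
  nerve_map f (piece_simplex g (val x)) == p (val x).
Proof.
apply/eqP/val_inj => /=; apply: image_face; rewrite (fiberP2 g).
exact: nbar_sub (valP x).
Qed.

Definition piece (s : {fset S'}) (g : fiber f (nbar p s)) (x : s) : P :=
  exist _ (piece_simplex g (val x), val x) (pieceP g x).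

(* The inverse of glue_fiber: the set of the (g_x, x), for x in s, where g_x is
   the face of g over p(x). *)
Definition unglue (s : {fset S'}) (g : fiber f (nbar p s)) : {fset P} :=
  [fset piece g x | x : s].

Lemma in_unglue (s : {fset S'}) (g : fiber f (nbar p s)) (w : P) :
  (w \in unglue g) =
  ((val w).2 \in s) && (val (val w).1 == face f (val g) (val (p (val w).2))).
Proof.
apply/imfsetP/andP => [[/= x _ ->] /=|[ws /eqP wE]]; first by rewrite (valP x).
by exists [` ws] => //; apply: pb_eq.
Qed.

Lemma unglue_fiberP (s : {fset S'}) (sP : simp S' s) (g : fiber f (nbar p s)) :
  simp P (unglue g) && (pb_snd (nerve_map f) p @` unglue g == s).
Proof.
have E : [fset (val w).2 | w in unglue g] = s.
  apply/fsetP => x; apply/imfsetP/idP => [[w /=]|xs].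
    by rewrite in_unglue => /andP[ws _] ->.
  by exists (piece g [` xs]); rewrite // in_unglue /= xs /=.
apply/andP; split; last by apply/eqP.
rewrite pb_simpE; apply/andP; split; last by rewrite E.
rewrite nerve_simp_image.
apply: simpS (fiberP1 g); apply/fsubsetP => v /ubarP[w].
by rewrite in_unglue => /andP[_ /eqP ->]; rewrite in_face => /andP[].
Qed.

Definition unglue_fiber (s : {fset S'}) (sP : simp S' s)
  (g : fiber f (nbar p s)) : fiber (pb_snd (nerve_map f) p) s :=
  exist _ (unglue g) (unglue_fiberP sP g).

Lemma unglueK (s : {fset S'}) (sP : simp S' s) :
  cancel (unglue_fiber sP) (@glue_fiber s).
Proof.
move=> g; apply: val_inj => /=; apply/fsetP => v; apply/in_glue/idP => /=.
  by case=> w; rewrite in_unglue => /andP[_ /eqP ->]; rewrite in_face => /andP[].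
move=> vg; have : f v \in nbar p s by rewrite -(fiberP2 g) in_imfset.
case/ubarP => x xs fv; exists (piece g [` xs]).
  by rewrite in_unglue /= xs /=.
by rewrite /= in_face vg.
Qed.
End Glue.
Arguments glue_fiber {G S S'} f p {s} K.
Arguments unglue_fiber {G S S'} f p {s} sP g.

Lemma glueK (f : bscenario) (S' : complex)
    (p : smap S' (nerve (bbase f))) (s : {fset S'}) (sP : simp S' s) :
  cancel (glue_fiber f p (s := s)) (unglue_fiber f p sP).
Proof.
move=> K; have gP := fiberP1 (glue_fiber f p K).
have sub w : w \in val K -> val (val w).1 = face f (glue (val K)) (val (p (val w).2)).
  move=> wK; apply: face_uniq gP _ _; last exact: pb_val.
  by apply/fsubsetP => v vw; apply/in_glue; exists w.
have inS x : (x \in s) = (x \in pb_snd (nerve_map f) p @` val K).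
  by rewrite (fiberP2 K).
apply: val_inj => /=; apply/fsetP => w; rewrite in_unglue /=.
apply/andP/idP => [[ws /eqP wE]|wK].
  move: ws; rewrite inS => /imfsetP[w' /= w'K E].
  suff -> : w = w' by [].
  apply: pb_eq => //; apply: (etrans wE); apply: (etrans _ (esym (sub _ w'K))).
  by congr (face f _ (val (p _))).
split; last by apply/eqP; exact: sub.
by rewrite inS; exact: (in_imfset imfset_key (pb_snd (nerve_map f) p) wK).
Qed.

Section Assoc.
Variables (G S S' S'' : complex) (f : smap G S) (p : smap S' (nerve S))
  (q : smap S'' (nerve S')).

Notation P := (pullback (nerve_map f) p).
Notation PP := (pullback (nerve_map (pb_snd (nerve_map f) p)) q).
Notation PK := (pullback (nerve_map f) (kleisli p q)).

Lemma pp_fiberP (w : PP) :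
  simp P (val (val w).1) &&
    (pb_snd (nerve_map f) p @` val (val w).1 == val (q (val w).2)).
Proof. by rewrite (valP (val w).1); apply/eqP; exact: pb_val. Qed.

Definition pp_fiber (w : PP) : fiber (pb_snd (nerve_map f) p) (val (q (val w).2)) :=
  exist _ (val (val w).1) (pp_fiberP w).

Lemma pk_fiberP (w : PK) :
  simp G (val (val w).1) &&
    (f @` val (val w).1 == nbar p (val (q (val w).2))).
Proof. by rewrite (valP (val w).1); apply/eqP; exact: pb_val. Qed.

Definition pk_fiber (w : PK) : fiber f (nbar p (val (q (val w).2))) :=
  exist _ (val (val w).1) (pk_fiberP w).

Definition glue_simplex (w : PP) : simplex G :=
  exist _ (glue (val (val w).1)) (glue_simp (valP (val w).1)).

Lemma glue_vertP (w : PP) :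
  nerve_map f (glue_simplex w) == kleisli p q (val w).2.
Proof. by apply/eqP/val_inj; apply: fiberP2 (glue_fiber f p (pp_fiber w)). Qed.

Definition glue_vert (w : PP) : PK :=
  exist _ (glue_simplex w, (val w).2) (glue_vertP w).

Lemma glue_mapP (K : {fset PP}) : simp PP K -> simp PK (glue_vert @` K).
Proof.
rewrite 2!pb_simpE => /andP[KA KB]; rewrite -!imfset_comp; apply/andP; split.
  rewrite (nerve_simp_image (fun w => glue_simplex w)) /=.
  rewrite (ubar_comp (fun w : P => val (val w).1)); apply: glue_simp.
  by move: KA; rewrite nerve_simp_image.
exact: KB.
Qed.

(* The identification (K, x) |-> (glue K, x) of PP with PK, of inverse unglue_map
   when f is a bundle scenario (unglue_mapK, glue_mapK). *)
Definition glue_map : smap PP PK := SMap glue_mapP.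

Definition unglue_simplex (w : PK) : simplex P :=
  exist _ (unglue (pk_fiber w))
    (fiberP1 (unglue_fiber f p (valP (q (val w).2)) (pk_fiber w))).

Lemma unglue_vertP (w : PK) :
  nerve_map (pb_snd (nerve_map f) p) (unglue_simplex w) == q (val w).2.
Proof.
apply/eqP/val_inj.
exact: (fiberP2 (unglue_fiber f p (valP (q (val w).2)) (pk_fiber w))).
Qed.

Definition unglue_vert (w : PK) : PP :=
  exist _ (unglue_simplex w, (val w).2) (unglue_vertP w).

Lemma unglue_mapP (K : {fset PK}) : simp PK K -> simp PP (unglue_vert @` K).
Proof.
rewrite 2!pb_simpE => /andP[KA KB]; rewrite -!imfset_comp; apply/andP; split; last first.
  exact: KB.
rewrite (nerve_simp_image (fun w => unglue_simplex w)) pb_simpE; apply/andP; split.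
  move: KA; rewrite !nerve_simp_image; apply: simpS.
  apply/fsubsetP => x /ubarP[w] /ubarP[v vK].
  rewrite in_unglue => /andP[_ /eqP ->]; rewrite in_face => /andP[xv _].
  by apply/ubarP; exists v.
move: (nbarP q KB); apply: simpS; apply/fsubsetP => x /imfsetP[w /=].
case/ubarP => v vK; rewrite in_unglue => /andP[wq _] ->.
apply/ubarP; exists (val v).2 => //.
exact: (in_imfset imfset_key (fun w : PK => (val w).2) vK).
Qed.

Definition unglue_map : smap PK PP := SMap unglue_mapP.

Lemma unglue_mapK : cancel unglue_map glue_map.
Proof.
move=> w; apply: pb_eq => //=.
exact: (congr1 val (unglueK (valP (q (val w).2)) (pk_fiber w))).
Qed.
End Assoc.
Arguments glue_map {G S S' S''} f p q.
Arguments unglue_map {G S S' S''} f p q.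

Lemma glue_mapK (f : bscenario) (S' S'' : complex)
    (p : smap S' (nerve (bbase f))) (q : smap S'' (nerve S')) :
  cancel (glue_map f p q) (unglue_map f p q).
Proof.
move=> w; apply: pb_eq => //=.
apply: etrans _ (congr1 val (glueK (valP (q (val w).2)) (pp_fiber w))).
apply/fsetP => v; rewrite [RHS]in_unglue; exact: in_unglue.
Qed.

Definition delta_simplex (S : complex) (x : S) : simplex S :=
  exist _ [fset x] (simp1 x).

Lemma deltaP (S : complex) s : simp S s -> simp (nerve S) (@delta_simplex S @` s).
Proof.
by move=> sP; rewrite nerve_simp_image /= /ubar bigfcup_imfset1 imfset_id.
Qed.

Definition delta (S : complex) : smap S (nerve S) := SMap (@deltaP S).

Section Unit.
Variable f : bscenario.
Notation P := (pullback (nerve_map f) (delta (bbase f))).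

Lemma unit_ex (w : P) : exists v, val (val w).1 == [fset v].
Proof.
have := pb_val w; rewrite /= => E.
have : (val w).2 \in f @` val (val w).1 by rewrite E fset11.
case/imfsetP => v /= vw fv; exists v; apply/eqP/fsetP => u; rewrite in_fset1.
apply/idP/eqP => [uw|->//]; apply: (bundle_inj (valP (val w).1)) => //.
have : f u \in f @` val (val w).1 by rewrite in_imfset.
by rewrite E fv => /fset1P.
Qed.

(* The identification of delta^*(NG) with G, of inverse v |-> ({v}, f v) *)
Definition unit_vert (w : P) : btot f := xchoose (unit_ex w).

Lemma unit_vertE (w : P) : val (val w).1 = [fset unit_vert w].
Proof. exact/eqP/(xchooseP (unit_ex w)). Qed.

Lemma unit_vertP (w : P) : f (unit_vert w) = (val w).2.
Proof.
by have := pb_val w; rewrite unit_vertE imfset_fset1 => /fset1_inj.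
Qed.

Lemma unit_simpP (K : {fset P}) : simp P K -> simp (btot f) (unit_vert @` K).
Proof.
rewrite pb_simpE => /andP[+ _]; rewrite nerve_simp_image.
congr simp; apply/fsetP => v.
apply/ubarP/imfsetP => -[w wK]; first by rewrite unit_vertE => /fset1P ->; exists w.
by move=> ->; exists w; rewrite ?unit_vertE ?fset11.
Qed.

Definition unit_map : smap P (btot f) := SMap unit_simpP.
End Unit.

Record bmor (f f' : bscenario) := BMor {
  bpi : smap (bbase f') (nerve (bbase f));
  balpha : smap (pullback (nerve_map f) bpi) (btot f');
  balphaP : forall w, f' (balpha w) = pb_snd (nerve_map f) bpi w }.
Arguments balphaP {f f'} m w : rename.

Lemma bmor_eq (f f' : bscenario) (m n : bmor f f') :
  bpi m =1 bpi n ->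
  (forall w w', val w = val w' -> balpha m w = balpha n w') -> m = n.
Proof.
case: m n => [p a ha] [q b hb] /= E0; have E : p = q := @smap_eq _ (nerve _) p q E0.
move: a ha; rewrite {}E => {E0} a ha ab.
have {}ab : a = b by apply: smap_eq => w; exact: ab.
by rewrite {}ab in ha *; rewrite (Prop_irrelevance ha hb).
Qed.

Lemma bid_over (f : bscenario) w :
  f (unit_map f w) = pb_snd (nerve_map f) (delta (bbase f)) w.
Proof. exact: unit_vertP. Qed.

Definition bid (f : bscenario) : bmor f f := BMor (@bid_over f).

Lemma nerve_over (f f' : bscenario) (m : bmor f f') w :
  nerve_map f' (nerve_map (balpha m) w) =
  nerve_map (pb_snd (nerve_map f) (bpi m)) w.
Proof.
apply: val_inj; rewrite /= -imfset_comp; apply: eq_imfset => // v.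
exact: balphaP.
Qed.
Arguments nerve_over {f f'} m w.

Definition bcomp_alpha (f f1 f2 : bscenario) (m2 : bmor f1 f2) (m1 : bmor f f1) :
    smap (pullback (nerve_map f) (kleisli (bpi m1) (bpi m2))) (btot f2) :=
  smap_comp (balpha m2)
    (smap_comp (pb_map (bpi m2) (nerve_over m1))
       (unglue_map f (bpi m1) (bpi m2))).

Lemma bcomp_over (f f1 f2 : bscenario) (m2 : bmor f1 f2) (m1 : bmor f f1) w :
  f2 (bcomp_alpha m2 m1 w) =
  pb_snd (nerve_map f) (kleisli (bpi m1) (bpi m2)) w.
Proof.
set t := pb_map (bpi m2) (nerve_over m1) (unglue_map f (bpi m1) (bpi m2) w).
by change (f2 (balpha m2 t) = (val t).2); rewrite balphaP.
Qed.
Arguments bcomp_over {f f1 f2} m2 m1 w.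

Definition bcomp (f f1 f2 : bscenario) (m2 : bmor f1 f2) (m1 : bmor f f1) :
  bmor f f2 := BMor (bcomp_over m2 m1).

Lemma bcomp_alphaE (f f1 f2 : bscenario) (m2 : bmor f1 f2) (m1 : bmor f f1)
    (w : pullback (nerve_map f) (kleisli (bpi m1) (bpi m2)))
    (t : pullback (nerve_map f1) (bpi m2)) :
  val (val t).1 = balpha m1 @` unglue (pk_fiber w) -> (val t).2 = (val w).2 ->
  balpha (bcomp m2 m1) w = balpha m2 t.
Proof.
move=> E1 E2; apply: (congr1 (balpha m2)); apply: pb_eq; first exact: esym E1.
exact: esym E2.
Qed.

Lemma unglue_snd (G S S' : complex) (f : smap G S) (p : smap S' (nerve S))
    (s : {fset S'}) (sP : simp S' s) (g : fiber f (nbar p s)) :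
  pb_snd (nerve_map f) p @` unglue g = s.
Proof. exact: fiberP2 (unglue_fiber f p sP g). Qed.

Lemma eq_imfset2 (A B C I : choiceType) (U : {fset A}) (T : {fset B})
    (a : A -> C) (b : B -> C) (i : A -> I) (j : B -> I) :
  i @` U = j @` T ->
  (forall u t, u \in U -> t \in T -> i u = j t -> a u = b t) ->
  a @` U = b @` T.
Proof.
move=> E H; apply/fsetP => c; apply/imfsetP/imfsetP => /= -[x xP ->].
  have : i x \in j @` T by rewrite -E in_imfset.
  by case/imfsetP => t /= tT it; exists t => //; exact: H.
have : j x \in i @` U by rewrite E in_imfset.
by case/imfsetP => u /= uU ju; exists u => //; exact/esym/H.
Qed.

Lemma bcomp1m (f f' : bscenario) (m : bmor f f') : bcomp (bid f') m = m.
Proof.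
apply: bmor_eq => [x|w w' ww']; first by apply: val_inj; rewrite /= /nbar ubar1.
set t := pb_map _ (nerve_over m) (unglue_map f (bpi m) (delta (bbase f')) w).
change (unit_vert t = balpha m w'); apply/esym/fset1P; rewrite -unit_vertE.
apply/imfsetP; exists w' => //; rewrite in_unglue; apply/andP; split.
  by apply/fset1P; rewrite -[(val w').2]/(pb_snd _ _ w') /= -ww'.
apply/eqP; apply: (face_uniq (fiberP1 (pk_fiber w))); last exact: pb_val.
by rewrite /= -ww'.
Qed.

Lemma bcompm1 (f f' : bscenario) (m : bmor f f') : bcomp m (bid f) = m.
Proof.
apply: bmor_eq => [x|w w' ww'].
  by apply: val_inj; rewrite /= /nbar /ubar bigfcup_imfset1 imfset_id.
apply: bcomp_alphaE; last by rewrite -ww'.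
rewrite -ww'; apply/fsetP => v; apply/idP/imfsetP => [vw|].
  have fv : f v \in nbar (delta (bbase f)) (val (bpi m (val w).2)).
    by rewrite -(fiberP2 (pk_fiber w)); exact: in_imfset.
  have fv' : f v \in val (bpi m (val w).2).
    by move: fv; rewrite /nbar /ubar bigfcup_imfset1 imfset_id.
  exists (piece (pk_fiber w) [` fv']).
    by rewrite in_unglue /= fv' /=.
  by apply/fset1P; rewrite -unit_vertE /= in_face vw fset11.
case=> u; rewrite in_unglue => /andP[_ /eqP uE] ->.
have : unit_vert u \in val (val u).1 by rewrite unit_vertE fset11.
by rewrite uE in_face => /andP[].
Qed.

Lemma face_face (G S : complex) (f : smap G S) g (s t : {fset S}) :
  t `<=` s -> face f (face f g s) t = face f g t.
Proof.
move=> /fsubsetP ts; apply/fsetP => v; rewrite !in_face.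
by case: (v \in g) => //=; case vt: (f v \in t) => //=; rewrite ?andbF ?ts ?vt.
Qed.

Lemma face_image_unglue (f f1 : bscenario) (m : bmor f f1)
    (s t : {fset bbase f1}) (g : fiber f (nbar (bpi m) s))
    (g' : fiber f (nbar (bpi m) t)) : t `<=` s ->
  val g' = face f (val g) (nbar (bpi m) t) ->
  face f1 (balpha m @` unglue g) t = balpha m @` unglue g'.
Proof.
move=> ts gE.
have key x : x \in t ->
    face f (val g') (val (bpi m x)) = face f (val g) (val (bpi m x)).
  by move=> xt; rewrite gE; apply: face_face; exact: nbar_sub.
apply/fsetP => y; rewrite in_face; apply/andP/imfsetP => /=.
  case=> /imfsetP[/= r]; rewrite in_unglue => /andP[rs /eqP rE] ->.
  rewrite balphaP => rt; exists r => //.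
  rewrite in_unglue; apply/andP; split; first exact: rt.
  apply/eqP; exact: (etrans rE (esym (key _ rt))).
case=> r; rewrite in_unglue => /andP[rt /eqP rE] ->.
split; last by rewrite balphaP.
apply: in_imfset; rewrite in_unglue; apply/andP; split.
  exact: (fsubsetP ts).
apply/eqP; exact: (etrans rE (key _ rt)).
Qed.

Lemma bcompA (f f1 f2 f3 : bscenario) (m : bmor f2 f3) (n : bmor f1 f2)
    (q : bmor f f1) : bcomp m (bcomp n q) = bcomp (bcomp m n) q.
Proof.
apply: bmor_eq => [x|w w' ww']; first by apply: val_inj; rewrite /= nbar_kleisli.
set t := pb_map (kleisli (bpi n) (bpi m)) (nerve_over q)
  (unglue_map f (bpi q) (kleisli (bpi n) (bpi m)) w').
set t' := pb_map (bpi m) (nerve_over n) (unglue_map f1 (bpi n) (bpi m) t).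
change (balpha (bcomp m (bcomp n q)) w = balpha m t').
have E2 : (val w).2 = (val w').2 by rewrite ww'.
apply: bcomp_alphaE => //.
have I1 := unglue_snd (valP (bpi m (val w).2)) (pk_fiber w).
have I2 := unglue_snd (valP (bpi m (val t).2)) (pk_fiber t).
change (balpha n @` unglue (pk_fiber t) =
   balpha (bcomp n q) @` unglue (pk_fiber w)).
apply/esym/(eq_imfset2 (etrans I1 (etrans _ (esym I2)))); first by rewrite E2.
move=> u v; rewrite 2!in_unglue => /andP[uw /eqP uE] /andP[vt /eqP vE] uv.
have {}uv : (val u).2 = (val v).2 by [].
apply: bcomp_alphaE => //; rewrite vE -uv.
apply: (face_image_unglue (g := pk_fiber w') (g' := pk_fiber u)); last first.
  by apply: etrans uE _; rewrite /= ww'.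
by rewrite E2 in uw; exact: (@nbar_sub _ _ (bpi n) _ _ uw).
Qed.

Definition bScen : category := Category bcomp1m bcompm1 bcompA.

Section Pull.
Variables (R : comPzSemiRingType) (U V : choiceType) (h : U -> V) (k : V -> U).
Hypotheses (hK : cancel h k) (kK : cancel k h).
Variable p : dist R V.

Definition pull_fsfun : {fsfun U -> R with 0%R} :=
  [fsfun u in k @` finsupp p => p (h u)].

Lemma pull_fsfunE u : pull_fsfun u = p (h u).
Proof.
rewrite fsfunE; case: ifPn => // uN; apply/esym/fsfun_dflt.
by apply: contra uN => uP; rewrite -[u]hK in_imfset.
Qed.

Lemma pull_fsfun_push : pull_fsfun = push k p.
Proof.
apply/fsfunP => u; rewrite pull_fsfunE -{2}[u]hK push_inj //.
exact: can_inj kK.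
Qed.

Lemma pull_subproof : (\sum_(u <- finsupp pull_fsfun) pull_fsfun u == 1)%R.
Proof. by rewrite pull_fsfun_push; exact: distP. Qed.

(* Relabelling along a bijection, characterized by pullE *)
Definition pull : dist R U := Dist pull_subproof.

Lemma pullE u : pull u = p (h u).
Proof. exact: pull_fsfunE. Qed.

Lemma pull_push : pull = push k p.
Proof. by apply: dist_eq => u; rewrite /= pull_fsfun_push. Qed.
End Pull.

Section BEmp.
Variable R : comPzSemiRingType.

Definition bemp (f : bscenario) : Type :=
  {p : forall s : simplex (bbase f), dist R (fiber f (val s)) |
     forall (s t : simplex (bbase f)) (h : val t `<=` val s),
       push (res_fiber h) (p s) = p t}.

Lemma bemp_eq (f : bscenario) (p q : bemp f) :
  (forall s, sval p s = sval q s) -> p = q.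
Proof.
case: p q => [p hp] [q hq] /= E0.
have E : p = q by exact: functional_extensionality_dep.
by rewrite {}E in hp *; rewrite (Prop_irrelevance hp hq).
Qed.

Definition bemp_pull (f : bscenario) (S' : complex)
    (pi : smap S' (nerve (bbase f))) (p : bemp f) (s : simplex S') :
    dist R (fiber (pb_snd (nerve_map f) pi) (val s)) :=
  pull (glueK (p := pi) (valP s)) (unglueK (f := f) (p := pi) (valP s))
    (sval p (nbar_simplex pi s)).

Lemma alpha_fiberP (f f' : bscenario) (m : bmor f f') (s : {fset bbase f'})
    (K : fiber (pb_snd (nerve_map f) (bpi m)) s) :
  simp (btot f') (balpha m @` val K) && (f' @` (balpha m @` val K) == s).
Proof.
rewrite (smapP (balpha m) (fiberP1 K)) -imfset_comp /=; apply/eqP.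
apply: etrans (fiberP2 K); apply: eq_imfset => // w; exact: balphaP.
Qed.

Definition alpha_fiber (f f' : bscenario) (m : bmor f f') (s : {fset bbase f'})
    (K : fiber (pb_snd (nerve_map f) (bpi m)) s) : fiber f' s :=
  exist _ (balpha m @` val K) (alpha_fiberP K).
Arguments alpha_fiber {f f'} m {s} K.

Definition bemp_mor_fun (f f' : bscenario) (m : bmor f f') (p : bemp f)
    (s : simplex (bbase f')) : dist R (fiber f' (val s)) :=
  push (alpha_fiber m) (bemp_pull (bpi m) p s).

Lemma bemp_mor_funE (f f' : bscenario) (m : bmor f f') (p : bemp f)
    (s : simplex (bbase f')) (t : simplex (bbase f))
    (h : nbar (bpi m) (val s) `<=` val t) :
  bemp_mor_fun m p s =
  push (fun g => alpha_fiber m (unglue_fiber f (bpi m) (valP s) (res_fiber h g)))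
    (sval p t).
Proof.
rewrite /bemp_mor_fun /bemp_pull pull_push.
rewrite -(svalP p t (nbar_simplex (bpi m) s) h) !push_comp; exact: eq_push.
Qed.

Lemma bemp_morP (f f' : bscenario) (m : bmor f f') (p : bemp f)
    (s t : simplex (bbase f')) (h : val t `<=` val s) :
  push (res_fiber h) (bemp_mor_fun m p s) = bemp_mor_fun m p t.
Proof.
rewrite (bemp_mor_funE (t := nbar_simplex (bpi m) s) p (fsubset_refl _)).
rewrite (bemp_mor_funE (t := nbar_simplex (bpi m) s) p (ubarS _ h)) push_comp.
apply: eq_push => g; apply: val_inj => /=; apply: face_image_unglue => //=.
rewrite face_face //; exact: ubarS.
Qed.

Definition bemp_mor (f f' : bscenario) (m : bmor f f') (p : bemp f) : bemp f' :=
  exist _ (bemp_mor_fun m p) (@bemp_morP f f' m p).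

Lemma bemp_functorP :
  @is_functor bScen SetCat (@FunctorData bScen SetCat bemp bemp_mor).
Proof.
split=> [f|f f1 f2 m n]; apply: funext => p; apply: bemp_eq => s /=.
  have h : nbar (delta (bbase f)) (val s) `<=` val s.
    by rewrite /nbar /ubar bigfcup_imfset1 imfset_id.
  rewrite (bemp_mor_funE (m := bid f) p h); apply: push_id => g.
  apply: val_inj; change (@unit_vert f @` unglue (res_fiber h g) = val g).
  apply/fsetP => v; apply/imfsetP/idP.
    case=> u; rewrite in_unglue => /andP[_ /eqP uE] ->.
    have : unit_vert u \in val (val u).1 by rewrite unit_vertE fset11.
    by rewrite uE !in_face => /andP[/andP[]].
  move=> vg; have fv : f v \in val s.
    have : f v \in f @` val g by exact: in_imfset.
    by rewrite (fiberP2 g).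
  exists (piece (res_fiber h g) [` fv]); first by rewrite in_unglue /= fv /=.
  apply/fset1P; rewrite -unit_vertE /= !in_face vg fset11 andbT /=.
  by rewrite /nbar /ubar bigfcup_imfset1 imfset_id.
pose c := nbar_simplex (kleisli (bpi n) (bpi m)) s.
have h : nbar (bpi n) (nbar (bpi m) (val s)) `<=` val c.
  by rewrite /= nbar_kleisli.
rewrite (bemp_mor_funE (t := c) (m := bcomp m n) p (fsubset_refl _)).
rewrite (bemp_mor_funE (t := nbar_simplex (bpi m) s) _ (fsubset_refl _)) /=.
rewrite (bemp_mor_funE (m := n) (s := nbar_simplex (bpi m) s) (t := c) p h) push_comp; apply: eq_push => g.
apply: val_inj => /=; set gl := res_fiber _ g; set gr := res_fiber _ _.
have I1 := unglue_snd (valP s) gl; have I2 := unglue_snd (valP s) gr.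
apply: (eq_imfset2 (etrans I1 (esym I2))) => u t.
rewrite 2!in_unglue => /andP[us /eqP uE] /andP[ts /eqP tE] ut.
have {}ut : (val u).2 = (val t).2 by [].
have us' : val (bpi m (val u).2) `<=` nbar (bpi m) (val s) by exact: nbar_sub.
apply: bcomp_alphaE => //; rewrite tE -ut.
apply: etrans (face_face _ _ us') _.
apply: (face_image_unglue (g := res_fiber h g) (g' := pk_fiber u)) => //.
apply: etrans uE _; rewrite [RHS]/= face_face; last exact: ubarS.
by apply: face_face; exact: nbar_sub.
Qed.

Definition bEmp : functor bScen SetCat := Functor bemp_functorP.
End BEmp.

Section Graph.
Variables (V : choiceType) (O : V -> choiceType).

Definition graph (s : {fset V}) (f : sections O s) : {fset {x : V & O x}} :=
  [fset existT O (val x) (f x) | x : s].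

Lemma in_graph (s : {fset V}) (f : sections O s) x (xs : x \in s) :
  existT O x (f [` xs]) \in graph f.
Proof. by apply/imfsetP; exists [` xs]. Qed.

Lemma graphP (s : {fset V}) (f : sections O s) (u : {x : V & O x}) :
  reflect (exists xs : tag u \in s, u = existT O (tag u) (f [` xs]))
    (u \in graph f).
Proof.
apply: (iffP idP) => [/imfsetP[[x xs] _ ->] /=|[xs ->]]; first by exists xs.
exact: in_graph.
Qed.

Lemma tag_graph (s : {fset V}) (f : sections O s) :
  [fset tag u | u in graph f] = s.
Proof.
apply/fsetP => x; apply/imfsetP/idP => /= [[u /graphP[xs _] ->] //|xs].
by exists (existT O x (f [` xs])); first exact: in_graph.
Qed.

Lemma graph_tag_inj (s : {fset V}) (f : sections O s) :
  {in graph f &, injective tag}.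
Proof.
move=> [x a] [y b] /graphP[/= xs ->] /graphP[/= ys ->] /= E.
by case: _ / E in ys *; rewrite (bool_irrelevance xs ys).
Qed.

Lemma graph_inj (s : {fset V}) : injective (@graph s).
Proof.
move=> f g fg; apply/ffunP => -[x xs].
have : existT O x (f [` xs]) \in graph g by rewrite -fg in_graph.
case/graphP => /= ys /eqP; rewrite eq_Tagged /= => /eqP ->.
exact: sections_irr.
Qed.

Lemma exists_graph (K : {fset {x : V & O x}}) s :
  {in K &, injective tag} -> [fset tag u | u in K] = s ->
  exists f : sections O s, graph f = K.
Proof.
move=> KI <-; set s' := [fset tag u | u in K].
have H (x : s') : exists o : O (val x), existT O (val x) o \in K.
  by case: x => x /= /imfsetP[[y o] /= yK ->]; exists o.
exists [ffun x : s' => xchoose (H x)]; apply/fsetP => -[x o].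
have aux (xs : x \in s') : existT O x (xchoose (H [` xs])) \in K :=
  xchooseP (H [` xs]).
apply/graphP/idP => /= [[xs ->]|xoK]; first by rewrite ffunE aux.
have xs : x \in s' by apply/imfsetP; exists (existT O x o).
exists xs; rewrite ffunE; exact: (KI _ _ xoK (aux xs)).
Qed.

Lemma graph_restr (s t : {fset V}) (h : t `<=` s) (f : sections O s) :
  graph (restr h f) = [fset u in graph f | tag u \in t].
Proof.
apply/fsetP => u; rewrite !inE; apply/graphP/andP.
  case=> ut ->; rewrite ffunE; split=> //; exact: in_graph.
case=> /graphP[us ->] /= ut; exists ut; rewrite ffunE; congr existT.
exact: sections_irr.
Qed.
End Graph.

Section SecComplex.
Variable S : scenario.
Local Notation O := (@sout S).

Definition sec_simp : pred {fset {x : vert (sbase S) & O x}} := fun K =>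
  `[< exists (s : simplex (sbase S)) (f : sections O (val s)), K = graph f >].

Lemma sec_simpP K : reflect
  (simp (sbase S) [fset tag u | u in K] /\ {in K &, injective tag})
  (sec_simp K).
Proof.
apply: (iffP (asboolP _)) => [[s [f ->]]|[KP KI]].
  by split; [rewrite tag_graph (valP s)|exact: graph_tag_inj].
have [f fE] := exists_graph KI erefl.
by exists (exist (fun s => simp (sbase S) s) _ KP), f.
Qed.

Lemma sec_simp0 : sec_simp fset0.
Proof. by apply/sec_simpP; split=> [|u v]; rewrite ?imfset0 ?simp0 ?inE. Qed.

Lemma sec_simp1 u : sec_simp [fset u].
Proof.
apply/sec_simpP; split; first by rewrite imfset_fset1 simp1.
by move=> v w /fset1P -> /fset1P ->.
Qed.

Lemma sec_simpS (K L : {fset {x : vert (sbase S) & O x}}) :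
  L `<=` K -> sec_simp K -> sec_simp L.
Proof.
move=> /fsubsetP LK /sec_simpP[KP KI]; apply/sec_simpP; split.
  by apply: simpS KP; apply: subset_imfset.
by move=> u v uL vL; apply: KI; apply: LK.
Qed.

Definition sec_complex : complex := Complex sec_simp0 sec_simp1 sec_simpS.

Lemma sec_mapP (K : {fset sec_complex}) :
  simp sec_complex K -> simp (sbase S) [fset tag u | u in K].
Proof. by case/sec_simpP. Qed.

Definition sec_map : smap sec_complex (sbase S) := SMap sec_mapP.

Lemma simp_graph (s : {fset sbase S}) (f : sections O s) :
  simp (sbase S) s -> simp sec_complex (graph f).
Proof.
by move=> sP; apply/sec_simpP; rewrite tag_graph; split=> //; exact: graph_tag_inj.
Qed.

Lemma sec_bundle : is_bundle sec_map.
Proof.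
have [d] : inhabited (forall x, O x).
  have d0 (x : sbase S) : exists o : O x, True by case: (soutP x) => o; exists o.
  exact: (inhabits (fun x => projT1 (cid (d0 x)))).
split=> [s sP|g gP _ s sP gs|u v uv fuv].
- exists (graph [ffun x : s => d (val x)]); last exact: tag_graph.
  exact: simp_graph.
- have [/= _ gI] := sec_simpP _ gP.
  have [f fE] := exists_graph gI erefl.
  pose f' : sections O s := [ffun x : s =>
    match @idP (val x \in [fset tag u | u in g]) with
    | ReflectT xg => f [` xg] | _ => d (val x) end].
  exists (graph f'); split; [exact: simp_graph| |exact: tag_graph].
  apply/fsubsetP => u; rewrite -fE => /graphP[ug ->].
  have us := fsubsetP gs _ ug; apply/graphP; exists us; congr existT.
  rewrite ffunE /=; case: {-}_ / idP => // ug'; exact: sections_irr.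
- apply/negP => /sec_simpP[_ /(_ u v)]; rewrite !inE !eqxx orbT => /(_ isT isT fuv).
  exact/eqP.
Qed.

Definition sec_bscen : bscenario := BScenario sec_bundle.

Lemma graph_fiberP (s : simplex (sbase S)) (f : sections O (val s)) :
  simp sec_complex (graph f) && (sec_map @` graph f == val s).
Proof. by rewrite simp_graph ?(valP s) //=; apply/eqP; exact: tag_graph. Qed.

Definition graph_fiber (s : simplex (sbase S)) (f : sections O (val s)) :
  fiber sec_map (val s) := exist _ (graph f) (graph_fiberP f).

Lemma section_ex (s : {fset sbase S}) (g : fiber sec_map s) :
  exists f : sections O s, graph f == val g.
Proof.
have [_ gI] := sec_simpP _ (fiberP1 g).
by have [f fE] := exists_graph gI (fiberP2 g); exists f; apply/eqP.
Qed.

Definition section_of (s : {fset sbase S}) (g : fiber sec_map s) : sections O s :=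
  xchoose (section_ex g).

Lemma graph_section (s : {fset sbase S}) (g : fiber sec_map s) :
  graph (section_of g) = val g.
Proof. exact/eqP/(xchooseP (section_ex g)). Qed.
End SecComplex.

Lemma rel_simp (S' S : complex) (p : srel S' S) x : simp S (p x).
Proof. by rewrite -(ubar1 p); exact: srelP (simp1 x). Qed.

Lemma rel_nerveP (S' S : complex) (p : srel S' S) s : simp S' s ->
  simp (nerve S) ((fun x => exist _ (p x) (rel_simp p x) : simplex S) @` s).
Proof. by move=> sP; rewrite nerve_simp_image; exact: (srelP p). Qed.

Definition rel_nerve (S' S : complex) (p : srel S' S) : smap S' (nerve S) :=
  SMap (@rel_nerveP S' S p).

Section RMap.
Variables (S T : scenario) (m : scen_mor S T).

Notation P := (pullback (nerve_map (sec_map S)) (rel_nerve (sm_rel m))).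

Lemma pb_fiberP (w : P) :
  simp (sec_complex S) (val (val w).1) &&
    (sec_map S @` val (val w).1 == sm_rel m (val w).2).
Proof. by rewrite (valP (val w).1); apply/eqP; exact: pb_val. Qed.

(* A vertex (g, x) of P is identified with the pair of x and of the section over
   sm_rel m x whose graph is g. *)
Definition pb_section (w : P) : sections (@sout S) (sm_rel m (val w).2) :=
  section_of (exist _ (val (val w).1) (pb_fiberP w) : fiber (sec_map S) _).

Lemma sub_ubar1 (V W : choiceType) (p : V -> {fset W}) x : ubar p [fset x] `<=` p x.
Proof. by rewrite ubar1. Qed.

(* r(alpha) on vertices; r_mapE gives its value on arbitrary simplices. *)
Definition r_vert (w : P) : sec_complex T :=
  let x := (val w).2 in
  existT (@sout T) x
    (sm_nat m (delta_simplex x) (restr (sub_ubar1 (sm_rel m) x) (pb_section w))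
       [` fset11 x]).

Lemma r_vertE (w : P) (s : simplex (sbase T))
    (f : sections (@sout S) (val (rbar (sm_rel m) s))) (xs : (val w).2 \in val s) :
  val (val w).1 `<=` graph f ->
  r_vert w = existT (@sout T) (val w).2 (sm_nat m s f [` xs]).
Proof.
move=> wf; have x1s : [fset (val w).2] `<=` val s by rewrite fsub1set.
have E : restr (ubarS (sm_rel m) x1s) f =
    restr (sub_ubar1 (sm_rel m) (val w).2) (pb_section w).
  have l : sm_rel m (val w).2 `<=` val (rbar (sm_rel m) s).
    by rewrite -[X in X `<=` _](ubar1 (sm_rel m)); exact: ubarS.
  rewrite (_ : pb_section w = restr l f); first by apply/esym/restr_comp.
  apply: graph_inj; rewrite graph_section graph_restr.
  have fP := simp_graph f (valP (rbar (sm_rel m) s)).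
  have /= wE := pb_val w.
  apply/fsetP => u; rewrite !inE.
  have tu : u \in val (val w).1 -> tag u \in sm_rel m (val w).2.
    by move=> uw; rewrite -wE; apply/imfsetP; exists u.
  apply/idP/andP => [uw|[uf]]; first by split; [exact: (fsubsetP wf)|exact: tu].
  rewrite -wE => /imfsetP[v /= vw uv].
  by rewrite (graph_tag_inj uf (fsubsetP wf _ vw) uv).
rewrite /r_vert; congr existT.
have /(congr1 (fun g : sections (@sout T) [fset (val w).2] => g [` fset11 _])) :=
  sm_natP m (s := s) (t := delta_simplex (val w).2) x1s f.
rewrite ffunE -E => <-; exact: sections_irr.
Qed.

Lemma r_simpP (K : {fset P}) : simp P K -> simp (sec_complex T) (r_vert @` K).
Proof.
rewrite pb_simpE nerve_simp_image => /andP[KA KB].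
pose s : simplex (sbase T) :=
  exist (fun s => simp (sbase T) s) _ KB.
have gP : simp (sec_complex S) (glue K) &&
    (sec_map S @` glue K == val (rbar (sm_rel m) s)).
  by rewrite KA; apply/eqP; exact: image_glue.
pose f := section_of (exist _ (glue K) gP : fiber (sec_map S) _).
apply: simpS (simp_graph (sm_nat m s f) (valP s)).
apply/fsubsetP => u /imfsetP[w /= wK ->].
have ws : (val w).2 \in val s by apply/imfsetP; exists w.
rewrite (r_vertE (f := f) ws) ?in_graph // /f graph_section /=.
by apply/fsubsetP => v vw; exact: (introT (in_glue K v) (ex_intro2 _ _ w wK vw)).
Qed.

Definition r_map : smap P (sec_complex T) := SMap r_simpP.

Lemma r_over w : sec_map T (r_map w) = pb_snd (nerve_map (sec_map S)) _ w.
Proof. by []. Qed.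

Definition r_mor : bmor (sec_bscen S) (sec_bscen T) :=
  @BMor (sec_bscen S) (sec_bscen T) (rel_nerve (sm_rel m)) r_map r_over.

Lemma rel_sub_rbar (s : simplex (sbase T)) (x : val s) :
  sm_rel m (val x) `<=` val (rbar (sm_rel m) s).
Proof. by apply/fsubsetP => y yx; apply/ubarP; exists (val x); first exact: valP. Qed.

Lemma pb_graph_vertP x (t : sections (@sout S) (sm_rel m x)) :
  nerve_map (sec_map S) (exist _ (graph t) (simp_graph t (rel_simp _ x))) ==
  rel_nerve (sm_rel m) x.
Proof. by apply/eqP/val_inj; exact: tag_graph. Qed.

Definition pb_graph_vert x (t : sections (@sout S) (sm_rel m x)) : P :=
  exist _ (exist _ (graph t) (simp_graph t (rel_simp _ x)), x) (pb_graph_vertP t).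

(* The simplex {(x, f restricted to pi(x)) : x in s} of P, that is, (s, f) *)
Definition pb_graph (s : simplex (sbase T))
    (f : sections (@sout S) (val (rbar (sm_rel m) s))) : {fset P} :=
  [fset pb_graph_vert (restr (rel_sub_rbar x) f) | x : val s].

Lemma r_mapE (s : simplex (sbase T)) f :
  r_map @` pb_graph f = graph (sm_nat m s f).
Proof.
have H x (xs : x \in val s) :
    r_vert (pb_graph_vert (restr (rel_sub_rbar [` xs]) f)) =
    existT (@sout T) x (sm_nat m s f [` xs]).
  apply: (@r_vertE (pb_graph_vert (restr (rel_sub_rbar [` xs]) f)) s f xs).
  by rewrite /= graph_restr; apply/fsubsetP => v; rewrite !inE => /andP[].
apply/fsetP => u; apply/imfsetP/graphP => /=.
  by case=> w /imfsetP[[x xs] _ ->] ->; exists xs; exact: H.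
case=> us ->; exists (pb_graph_vert (restr (rel_sub_rbar [` us]) f)).
  by apply/imfsetP; exists [` us].
by rewrite -H.
Qed.
End RMap.

Definition Escen : functor_data Scen bScen :=
  @FunctorData Scen bScen sec_bscen r_mor.

(* Main.v *)
(** A section f over s is the same as its graph, a simplex of the section complex
    lying over s; this bijection is natural in s and gives eta by relabelling.
    On a simplex, given by its graph, r(alpha) is alpha (r_map_unglue), so
    r determines alpha on every context; conversely a bundle morphism b acts on
    the fibre over each simplex, and reading this action on graphs gives a natural
    transformation, naturality being the fact that b commutes with taking faces. *)

Require Import Defs.
From mathcomp Require Import all_boot ssralg finmap.
From mathcomp Require Import boolp.

Set Implicit Arguments.
Unset Strict Implicit.
Unset Printing Implicit Defensive.

Local Open Scope fset_scope.

(** Simplices such as [ubar p (ubar q s)] and [ubar (srel_comp p q) s] are equal without being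
    convertible; passing to graphs erases the restriction between them. *)
Lemma graph_restr_full (V : choiceType) (O : V -> choiceType) (s t : {fset V})
    (h : t `<=` s) (f : sections O s) : s `<=` t -> graph (restr h f) = graph f.
Proof.
move=> /fsubsetP st; rewrite graph_restr; apply/fsetP => u; rewrite !inE.
by case: graphP => //= -[us _]; exact: st.
Qed.

Lemma graph_fiberK (S : scenario) (s : simplex (sbase S)) :
  cancel (@graph_fiber S s) (@section_of S (val s)).
Proof. by move=> f; apply: graph_inj; rewrite graph_section. Qed.

Lemma section_ofK (S : scenario) (s : simplex (sbase S)) :
  cancel (@section_of S (val s)) (@graph_fiber S s).
Proof. by move=> g; apply: val_inj; rewrite /= graph_section. Qed.

Lemma graph_fiber_restr (S : scenario) (s t : simplex (sbase S))
    (h : val t `<=` val s) (f : sections (@sout S) (val s)) :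
  res_fiber h (graph_fiber f) = graph_fiber (restr h f).
Proof. by apply: val_inj; rewrite /= graph_restr. Qed.

(** By [r_vertE], each vertex of [unglue g] goes to the point of the target graph over its second
    coordinate, and every vertex of [s] occurs, through [piece g]. *)
Lemma r_map_unglue (S T : scenario) (m : scen_mor S T) (s : simplex (sbase T))
    (f : sections (@sout S) (val (rbar (sm_rel m) s)))
    (g : fiber (sec_map S) (nbar (rel_nerve (sm_rel m)) (val s))) :
  val g = graph f -> r_map m @` unglue g = graph (sm_nat m s f).
Proof.
move=> gE.
have rE w : w \in unglue g -> exists ws : (val w).2 \in val s,
    r_vert w = existT (@sout T) (val w).2 (sm_nat m s f [` ws]).
  rewrite in_unglue => /andP[ws /eqP wE]; exists ws.
  by apply: r_vertE; rewrite wE -gE; exact: face_sub.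
apply/fsetP => u; apply/imfsetP/graphP => /= [[w /rE[ws wE] uw]|[us uE]].
  by rewrite (etrans uw wE); exists ws.
have pg : piece g [` us] \in unglue g by exact: in_imfset.
exists (piece g [` us]) => //; have [us' xE] := rE _ pg.
apply: (etrans uE); apply: etrans _ (esym xE); congr existT; exact: sections_irr.
Qed.

(** Both sides send a vertex [({v}, x)] to [v]: the transformation of [scen_id] is a restriction, so
    [r_vert w] is a point of the graph [{v}]. *)
Lemma r_mor_id (S : scenario) : r_mor (scen_id S) = bid (sec_bscen S).
Proof.
apply: bmor_eq => [x|w w' ww']; first exact: val_inj.
change (r_vert w = unit_vert w').
have : r_vert w \in graph (pb_section w).
  rewrite /r_vert /= !ffunE; exact: in_graph.
by rewrite graph_section /= ww' => rw; apply/fset1P; rewrite -(unit_vertE w').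
Qed.

Lemma r_mor_comp (S T U : scenario) (n : scen_mor T U) (m : scen_mor S T) :
  r_mor (scen_comp n m) = bcomp (r_mor n) (r_mor m).
Proof.
apply: bmor_eq => [x|w w' ww']; first exact: val_inj.
pose t := pb_map (bpi (r_mor n)) (nerve_over (r_mor m))
  (unglue_map (sec_map S) (bpi (r_mor m)) (bpi (r_mor n)) w').
change (r_vert w = r_vert t).
pose x := (val w).2.
pose f := restr (sub_ubar1 (sm_rel (scen_comp n m)) x) (pb_section w).
pose f0 := restr (scen_comp_sub (sm_rel m) (sm_rel n) [fset x]) f.
(* The intermediate section. Its graph will contain the first coordinate of [t], which lets
   [r_vertE] evaluate the outer morphism at [t]. *)
pose f' := sm_nat m (rbar (sm_rel n) (delta_simplex x)) f0.
have tx : (val t).2 = x by rewrite /x ww'.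
have xt : (val t).2 \in [fset x] by rewrite tx fset11.
have wE : graph f = val (val w').1.
  by rewrite graph_restr_full ?graph_section /= ?ww' // ubar1.
have f'E u : u \in unglue (pk_fiber w') -> r_vert u \in graph f'.
  rewrite in_unglue => /andP[ux /eqP uE].
  have ux' : (val u).2 \in val (rbar (sm_rel n) (delta_simplex x)).
    by rewrite /= ubar1 /x ww'.
  have uf : val (val u).1 `<=` graph f0.
    rewrite graph_restr_full ?wE ?uE; first exact: face_sub.
    by rewrite [X in X `<=` _]ubar_comp.
  rewrite (r_vertE (m := m) (s := rbar (sm_rel n) (delta_simplex x)) ux' uf).
  exact: in_graph.
rewrite (r_vertE (s := delta_simplex x) (f := f') xt).
  (* The second coordinate of [t] is only provably equal to [x]; a variable [y] in its place allows
     substitution in the dependent pair. *)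
  suff E y (yx : y \in [fset x]) : y = x ->
      existT _ x (sm_nat (scen_comp n m) (delta_simplex x) f [` fset11 x]) =
      existT (@sout U) y (sm_nat n (delta_simplex x) f' [` yx]) by exact: E.
  move: yx => /[swap] -> yx; congr existT; exact: sections_irr.
by apply/fsubsetP => v /imfsetP[/= u uP ->]; exact: f'E.
Qed.

Section InverseMor.
Variables (S T : scenario) (b : bmor (sec_bscen S) (sec_bscen T)).

Lemma bmor_relP s : simp (sbase T) s -> simp (sbase S) (ubar (fun x => val (bpi b x)) s).
Proof. exact: nbarP (bpi b) s. Qed.

Definition bmor_rel : srel (sbase T) (sbase S) := SRel bmor_relP.

(** [ubar bmor_rel s] is convertible to [nbar (bpi b) s], so that [graph_fiber f] can be unglued
    without transport. *)
Definition bmor_fiber (s : simplex (sbase T))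
    (f : sections (@sout S) (val (rbar bmor_rel s))) : fiber (sec_map T) (val s) :=
  alpha_fiber (m := b) (unglue_fiber (sec_map S) (bpi b) (valP s) (graph_fiber f)).

Definition bmor_nat (s : simplex (sbase T))
    (f : sections (@sout S) (val (rbar bmor_rel s))) : sections (@sout T) (val s) :=
  section_of (bmor_fiber f).

Lemma bmor_natP (s t : simplex (sbase T)) (h : val t `<=` val s) f :
  restr h (bmor_nat f) = bmor_nat (s := t) (restr (ubarS bmor_rel h) f).
Proof.
apply: graph_inj; rewrite graph_restr !graph_section.
apply: (face_image_unglue (f := sec_bscen S) (f1 := sec_bscen T) h) => /=.
exact: graph_restr.
Qed.

Definition bmor_scen : scen_mor S T := ScenMor bmor_natP.
End InverseMor.

Lemma r_morK (S T : scenario) : cancel (@r_mor S T) (@bmor_scen S T).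
Proof.
move=> m; apply: scen_mor_eq => [//|s h f]; apply: graph_inj.
rewrite restr_id graph_section; exact: r_map_unglue.
Qed.

(** It suffices to compare vertices, over a context [{x}]: there [unglue] yields the single vertex
    [w'], so [bmor_nat] reads off the value of [balpha b] at it. *)
Lemma bmor_scenK (S T : scenario) : cancel (@bmor_scen S T) (@r_mor S T).
Proof.
move=> b; apply: bmor_eq => [x|w w' ww']; first exact: val_inj.
pose x := (val w).2.
pose f := restr (sub_ubar1 (bmor_rel b) x) (pb_section w).
have : r_vert w \in graph (bmor_nat (s := delta_simplex x) f) by exact: in_graph.
pose g : fiber (sec_map S) (nbar (bpi b) [fset x]) :=
  graph_fiber (s := rbar (bmor_rel b) (delta_simplex x)) f.
rewrite graph_section => /imfsetP[u uP ruE].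
have : u \in unglue g by [].
rewrite in_unglue => /andP[/fset1P ux /eqP uE].
apply: etrans ruE _; congr (balpha b _).
have uw : (val u).2 = (val w').2 by rewrite ux /x ww'.
apply: pb_eq => //.
rewrite uE /g /= graph_restr_full ?graph_section /= ?ww' ?uw; last by rewrite ubar1.
(* A simplex is its own face over its whole image. *)
apply/esym/(face_uniq (f := sec_bscen S)); [exact: valP|exact: fsubset_refl|].
exact: pb_val.
Qed.

Section Eta.
Variable (R : comPzSemiRingType).

Lemma eta_subproof (S : scenario) (e : emp R S) (s t : simplex (sbase S))
    (h : val t `<=` val s) :
  push (res_fiber h) (push (@graph_fiber S s) (sval e s)) =
  push (@graph_fiber S t) (sval e t).
Proof.
rewrite -(svalP e s t h) !push_comp; apply: eq_push => f.
exact: graph_fiber_restr.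
Qed.

Definition eta_fun (S : scenario) (e : emp R S) : bemp R (sec_bscen S) :=
  exist _ (fun s => push (@graph_fiber S s) (sval e s)) (eta_subproof e).

Lemma eta_inv_subproof (S : scenario) (p : bemp R (sec_bscen S))
    (s t : simplex (sbase S)) (h : val t `<=` val s) :
  push (restr h) (push (@section_of S (val s)) (sval p s)) =
  push (@section_of S (val t)) (sval p t).
Proof.
rewrite -(svalP p s t h) !push_comp; apply: eq_push => g.
(* The two sections are compared through their graphs, where [restr] becomes [res_fiber]. *)
apply: (can_inj (@graph_fiberK S t)).
by rewrite -graph_fiber_restr /= !section_ofK.
Qed.

Definition eta_inv (S : scenario) (p : bemp R (sec_bscen S)) : emp R S :=
  exist _ (fun s => push (@section_of S (val s)) (sval p s)) (eta_inv_subproof p).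

Lemma eta_funK (S : scenario) : cancel (@eta_fun S) (@eta_inv S).
Proof.
move=> e; apply: emp_eq => s /=; rewrite push_comp.
apply: push_id; exact: graph_fiberK.
Qed.

Lemma eta_invK (S : scenario) : cancel (@eta_inv S) (@eta_fun S).
Proof.
move=> p; apply: bemp_eq => s /=; rewrite push_comp.
apply: push_id; exact: section_ofK.
Qed.

(** Both sides push forward the same distribution of [e], along maps that each send [f] to the graph
    of [sm_nat m s f]. *)
Lemma eta_natural (S T : scenario) (m : scen_mor S T) (e : emp R S) :
  bemp_mor (r_mor m) (eta_fun e) = eta_fun (emp_mor m e).
Proof.
apply: bemp_eq => s /=; have h : nbar (bpi (r_mor m)) (val s) `<=` val (rbar (sm_rel m) s).
  exact: fsubset_refl.
rewrite (bemp_mor_funE _ h) /= !push_comp; apply: eq_push => f.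
apply: val_inj; apply: r_map_unglue.
(* The restriction along [h] brought in by [bemp_mor_funE] is here the identity. *)
by apply: etrans (esym (graph_restr h f)) _; rewrite restr_id.
Qed.
End Eta.

Lemma Escen_functorP : is_functor Escen.
Proof. split=> [S|S T U n m]; [exact: r_mor_id|exact: r_mor_comp]. Qed.

Theorem theorem3p18 (R : comPzSemiRingType) (zsfR : zero_sum_free R) :
  exists EP : is_functor Escen,
    let E : functor Scen bScen := Functor EP in
    fully_faithful E /\
    exists eta : nat_trans (Emp R) (comp_functor (bEmp R) E),
      is_nat_iso eta /\
      forall (S : scenario) (e : emp R S) (s : simplex (sbase S))
             (f : sections (@sout S) (val s)),
        sval (eta S e) s (graph_fiber f) = sval e s f.
Proof.
exists Escen_functorP => E; split.
  by move=> S T; exists (@bmor_scen S T); [exact: r_morK|exact: bmor_scenK].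
have etaP (S T : Scen) (m : hom S T) :
    compm (fmor (comp_functor (bEmp R) E) m) (@eta_fun R S) =
    compm (c := SetCat) (@eta_fun R T) (fmor (Emp R) m).
  by apply: funext => e; exact: eta_natural.
exists (@NatTrans _ _ (Emp R) (comp_functor (bEmp R) E) (@eta_fun R) etaP).
split=> [S|S e s f].
  exists (@eta_inv R S); split; apply: funext; [exact: eta_funK|exact: eta_invK].
(* Distinct sections have distinct graphs, so the push-forward merges no values. *)
exact: push_inj (can_inj (@graph_fiberK S s)).
Qed.
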